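(* Let $P$ be a logic program over $\Sigma$ and $t\in\mathbf{Term}(\Sigma)$. (1) If $\mathrm{rew}(P,?\gets t,\sigma)$ is an inductive success tree for some $\sigma\in\mathbf{Subst}(\Sigma)$, then every ground instance $t'\in\mathbf{GTerm}(\Sigma)$ of $\sigma(t)$ belongs to $M_P$. (2) If $t\in M_P$, then there exists a grounding substitution $\theta\in\mathbf{Subst}(\Sigma)$ such that $\mathrm{rew}(P,?\gets t,\theta)$ is an inductive success tree.
   Context: Terms are finite first-order terms with variables over a signature $\Sigma$ containing at least one constant; $\mathbf{GTerm}(\Sigma)$ is the set of finite ground terms, $\mathbf{Subst}(\Sigma)$ the set of (idempotent) substitutions with finite-term codomain. A clause is $A\gets B_0,\ldots,B_m$ (body possibly empty); a goal clause is $?\gets B_0,\ldots,B_m$; a logic program $P$ is a finite list $P(0),\ldots,P(k)$ of non-goal clauses, viewed as functions on $\{\epsilon,0,\ldots,m\}$ with $C(\epsilon)$ the head, $C(j)=B_j$. $s\prec_\theta u$ means $\theta$ is a most general matcher of $s$ against $u$. Clause variables are renamed apart. $M_P$ (least Herbrand model) is the smallest set of finite ground terms such that whenever $A\gets B_1,\ldots,B_n$ is a clause of $P$, $\sigma$ is grounding, and $\sigma(B_1),\ldots,\sigma(B_n)\in M_P$, then $\sigma(A)\in M_P$. Rewriting tree $T=\mathrm{rew}(P,C,\sigma)$ ($V_R$ a set of or-node variables): $T(\epsilon)=\sigma(C)$, $T(i)=\sigma(C(i))$ for body positions $i$ of $C$; each odd-length node $w$ is a term with, for every clause index $i$ of $P$,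 a child $wi$ labelled $\sigma(\theta(P(i)))$ if $\mathrm{head}(P(i))\prec_\theta T(w)$, else a fresh variable of $V_R$; each even positive-length node is a clause or a variable; variables are leaves; a clause node $\sigma(\theta(P(i)))$ at $w$ has children $wj$ labelled $\sigma(\theta(P(i)(j)))$ for body positions $j$; no other nodes. Even-depth nodes are or-nodes, odd-depth are and-nodes. A rewriting subtree $T'$ of $T$ contains the root, all children of each of its even-depth nodes, and exactly one child of each of its odd-depth nodes (labels as in $T$). An inductive success node is a non-variable leaf or-node. $T$ is an inductive success tree if it has a finite rewriting subtree all of whose leaves are inductive success nodes. *)

(* Defs.v *)
From mathcomp Require Import all_boot.
From Stdlib Require Import ClassicalEpsilon.
Set Implicit Arguments.
Unset Strict Implicit.
Unset Printing Implicit Defensive.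

Record signature := Signature { sym :> Type; arity : sym -> nat }.

(* Variables are natural numbers.  There is no separate layer of predicates:
   atoms are terms. *)
Inductive term (S : signature) : Type :=
| Var of nat
| App (f : S) of {ffun 'I_(arity f) -> term S}.
Arguments Var {S}.

Fixpoint occurs (S : signature) (x : nat) (t : term S) : Prop :=
  match t with
  | Var y => x = y
  | App f a => exists i, occurs x (a i)
  end.

Definition ground (S : signature) (t : term S) : Prop :=
  forall x, ~ occurs x t.

Fixpoint app_term (S : signature) (s : nat -> term S) (t : term S) : term S :=
  match t with
  | Var x => s x
  | App f a => App [ffun i => app_term s (a i)]
  end.

(* The support of a substitution is not required to be finite: a substitution
   that is to instantiate all variables of a rewriting tree cannot be bound to
   finitely many variables in advance. *)
Record subst (S : signature) := Subst {
  sfun :> nat -> term S;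
  subst_idem : forall x, app_term sfun (sfun x) = sfun x
}.

Definition grounding (S : signature) (s : subst S) : Prop :=
  forall x, ground (s x).

Definition instance (S : signature) (t' t : term S) : Prop :=
  exists s : subst S, t' = app_term s t.

Definition matcher (S : signature) (s u : term S) (th : subst S) : Prop :=
  app_term th s = u.

Definition more_general (S : signature) (s s' : subst S) : Prop :=
  exists s'' : subst S, forall x, s' x = app_term s'' (s x).

(* The relation s \prec_th u *)
Definition mgm (S : signature) (s u : term S) (th : subst S) : Prop :=
  matcher s u th /\
  forall th' : subst S, matcher s u th' -> more_general th th'.

Record dclause (S : signature) := DClause {
  head : term S;
  body : seq (term S)
}.

Definition program (S : signature) := seq (dclause S).

Inductive clause (S : signature) : Type :=
| Definite of dclause S
| Goal of seq (term S).

Definition clause_body (S : signature) (C : clause S) : seq (term S) :=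
  match C with Definite c => body c | Goal bs => bs end.

Definition app_dclause (S : signature) (s : nat -> term S) (c : dclause S) :=
  DClause (app_term s (head c)) (map (app_term s) (body c)).

Definition app_clause (S : signature) (s : nat -> term S) (C : clause S) :=
  match C with
  | Definite c => Definite (app_dclause s c)
  | Goal bs => Goal (map (app_term s) bs)
  end.

Definition occurs_body (S : signature) (x : nat) (bs : seq (term S)) : Prop :=
  exists j B, onth bs j = Some B /\ occurs x B.

Definition occurs_dclause (S : signature) (x : nat) (c : dclause S) : Prop :=
  occurs x (head c) \/ occurs_body x (body c).

Definition occurs_clause (S : signature) (x : nat) (C : clause S) : Prop :=
  match C with
  | Definite c => occurs_dclause x c
  | Goal bs => occurs_body x bs
  end.

Inductive least_herbrand (S : signature) (P : program S) : term S -> Prop :=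
| LeastHerbrand i (c : dclause S) (s : subst S) :
    onth P i = Some c -> grounding s ->
    (forall j B, onth (body c) j = Some B ->
       least_herbrand P (app_term s B)) ->
    least_herbrand P (app_term s (head c)).

Definition position := seq nat.

(* Or-node variables form a sort of their own, disjoint from the term
   variables.  They are named by positions, and the one created at node w is w
   itself, which makes it fresh. *)
Inductive label (S : signature) : Type :=
| LClause of clause S
| LTerm of term S
| LOrVar of position.
Arguments LOrVar {S}.

Definition tree (S : signature) := position -> option (label S).

Definition variant (S : signature) (c c' : dclause S) : Prop :=
  exists2 r : nat -> nat, injective r & c' = app_dclause (fun x => Var (r x)) c.

(* Q w i is the renamed copy of the clause P(i) that is used to build the child
   w i of the and-node w. *)
Definition renaming (S : signature) := position -> nat -> dclause S.

(* If head c \prec_th u then the clause node sigma(th(c)), else an or-node variable.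
   When c shares no variable with u, the idempotent th is unique, so that the
   choice made here is immaterial. *)
Definition or_child (S : signature) (sigma : subst S) (c : dclause S)
    (u : term S) (w : position) : label S :=
  match excluded_middle_informative (exists th, mgm (head c) u th) with
  | left h =>
      let th := proj1_sig (constructive_indefinite_description _ h) in
      LClause (Definite (app_dclause sigma (app_dclause th c)))
  | right _ => LOrVar w
  end.

(* The label of the child w i of a node w labelled l.  The body terms of a
   clause label are already instantiated by sigma and th. *)
Definition child (S : signature) (Q : renaming S) (P : program S)
    (sigma : subst S) (w : position) (l : label S) (i : nat) :
    option (label S) :=
  match l with
  | LClause C => omap (@LTerm S) (onth (clause_body C) i)
  | LTerm u =>
      if i < size P then Some (or_child sigma (Q w i) u (rcons w i)) else None
  | LOrVar _ => None
  end.

Fixpoint descend (S : signature) (Q : renaming S) (P : program S)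
    (sigma : subst S) (w : position) (l : label S) (v : position) :
    option (label S) :=
  match v with
  | [::] => Some l
  | i :: v' =>
      match child Q P sigma w l i with
      | Some l' => descend Q P sigma (rcons w i) l' v'
      | None => None
      end
  end.

Definition rew (S : signature) (Q : renaming S) (P : program S)
    (C : clause S) (sigma : subst S) : tree S :=
  descend Q P sigma [::] (LClause (app_clause sigma C)).

(* The copies share variables neither with each other nor with the root
   clause C.  This does not involve the substitution of the tree, which may
   instantiate the variables of the copies. *)
Definition renamed_apart (S : signature) (Q : renaming S) (P : program S)
    (C : clause S) : Prop :=
  [/\ forall w i c, onth P i = Some c -> variant c (Q w i),
      forall w i w' i', i < size P -> i' < size P -> (w, i) <> (w', i') ->
        forall x, occurs_dclause x (Q w i) -> ~ occurs_dclause x (Q w' i')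
    & forall w i, i < size P ->
        forall x, occurs_dclause x (Q w i) -> ~ occurs_clause x C].

(* Each term label shares no variable with the copies matched against it. *)
Definition matched_apart (S : signature) (Q : renaming S) (P : program S)
    (C : clause S) (sigma : subst S) : Prop :=
  forall w u i, rew Q P C sigma w = Some (LTerm u) -> i < size P ->
    forall x, occurs_dclause x (Q w i) -> ~ occurs x u.

Definition node (S : signature) (T : tree S) (w : position) : Prop :=
  exists l, T w = Some l.

Definition leaf (S : signature) (T : tree S) (w : position) : Prop :=
  node T w /\ forall i, ~ node T (rcons w i).

Definition rewriting_subtree (S : signature) (T' T : tree S) : Prop :=
  [/\ node T' [::],
      forall w l, T' w = Some l -> T w = Some l,
      forall w i, node T' (rcons w i) -> node T' w,
      forall w i, node T' w -> ~~ odd (size w) ->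
        node T (rcons w i) -> node T' (rcons w i)
    & forall w, node T' w -> odd (size w) -> exists! i, node T' (rcons w i)].

Definition finite_tree (S : signature) (T : tree S) : Prop :=
  exists s : seq position, forall w, node T w -> w \in s.

Definition inductive_success_node (S : signature) (T : tree S) (w : position) :=
  [/\ ~~ odd (size w), leaf T w & forall X, T w <> Some (LOrVar X)].

Definition inductive_success_tree (S : signature) (T : tree S) : Prop :=
  exists T' : tree S,
    [/\ rewriting_subtree T' T, finite_tree T'
      & forall w, leaf T' w -> inductive_success_node T w].

(* Main.v *)
(* Soundness: every term label u satisfies u = sigma(u), because sigma is
   idempotent, so a ground instance tau(u) of a node matched by theta with the
   copy Q of P(i) is tau(sigma(theta(head Q))), and the clause instance
   tau o sigma o theta of Q derives it from the instances of the body labels.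
   Completeness: once all labels are ground, the most general matcher fixes the
   variables that occur only in the body of a copy.  The variables of the copies
   used by a derivation can therefore be bound in advance to the values that the
   derivation gives them; the copies being disjoint, these bindings do not
   conflict and form one grounding substitution. *)
Require Import Defs.
From mathcomp Require Import all_boot.
From Stdlib Require Import ClassicalEpsilon Eqdep.
(* so that [head] is the head of a clause and not [seq.head] *)
Import Defs.
Set Implicit Arguments.
Unset Strict Implicit.
Unset Printing Implicit Defensive.

(** * Terms and substitutions *)

(* The automatic principle has no induction hypothesis for the arguments, which
   are nested under a finite function. *)
Lemma term_nested_ind (S : signature) (K : term S -> Prop) :
  (forall x, K (Var x)) ->
  (forall f (a : {ffun 'I_(arity f) -> term S}),
      (forall i, K (a i)) -> K (App a)) ->
  forall t, K t.
Proof.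
move=> KV KA; fix IH 1; case=> [x|f a]; first exact: KV.
by apply: KA => i; apply: IH.
Qed.

Lemma app_term_ext (S : signature) (s s' : nat -> term S) t :
  (forall x, occurs x t -> s x = s' x) -> app_term s t = app_term s' t.
Proof.
elim/term_nested_ind: t => [x|f a IH] /= ss'; first exact: ss'.
by congr App; apply/ffunP => i; rewrite !ffunE; apply: IH => x xi;
  apply: ss'; exists i.
Qed.

Lemma app_term_inj (S : signature) (s s' : nat -> term S) t :
  app_term s t = app_term s' t -> forall x, occurs x t -> s x = s' x.
Proof.
elim/term_nested_ind: t => [x|f a IH] /= ss' y; first by move=> ->.
case=> i /IH; apply.
(* The type of the arguments depends on [f], so [injection] only yields an equality of dependent
   pairs. *)
have app_args (b b' : {ffun 'I_(arity f) -> term S}) : App b = App b' -> b = b'.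
  move=> E; injection E => E'.
  exact: (EqdepTheory.inj_pair2 _ _ _ _ _ E').
by move/app_args/ffunP/(_ i): ss'; rewrite !ffunE.
Qed.

Lemma app_term_comp (S : signature) (s s' : nat -> term S) t :
  app_term s (app_term s' t) = app_term (fun x => app_term s (s' x)) t.
Proof.
elim/term_nested_ind: t => [x|f a IH] //=.
by congr App; apply/ffunP => i; rewrite !ffunE.
Qed.

Lemma app_term_Var (S : signature) (t : term S) : app_term Var t = t.
Proof.
elim/term_nested_ind: t => [x|f a IH] //=.
by congr App; apply/ffunP => i; rewrite !ffunE.
Qed.

Lemma app_term_ground (S : signature) (s : nat -> term S) t :
  ground t -> app_term s t = t.
Proof.
by move=> gt; rewrite -[RHS]app_term_Var; apply: app_term_ext => x /gt.
Qed.

Lemma app_term_idem (S : signature) (s : subst S) t :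
  app_term s (app_term s t) = app_term s t.
Proof. by rewrite app_term_comp; apply: app_term_ext => x _; apply: subst_idem. Qed.

Lemma ground_app_term (S : signature) (s : nat -> term S) t :
  (forall x, ground (s x)) -> ground (app_term s t).
Proof.
move=> gs; elim/term_nested_ind: t => [x|f a IH] /=; first exact: gs.
by move=> x [i]; rewrite ffunE; apply: IH.
Qed.

Lemma ground_app_term_occurs (S : signature) (s : nat -> term S) t x :
  ground (app_term s t) -> occurs x t -> ground (s x).
Proof.
elim/term_nested_ind: t => [y|f a IH] /= gt; first by move=> ->.
case=> i; apply: IH => z zi; apply: (gt z); exists i.
by rewrite ffunE.
Qed.

Definition ground_subst (S : signature) (s : nat -> term S)
    (gs : forall x, ground (s x)) : subst S :=
  Subst (fun x => app_term_ground s (gs x)).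

Lemma ground_term_exists (S : signature) :
  (exists c : S, arity c = 0) -> exists t : term S, ground t.
Proof.
move=> [c c0]; exists (App [ffun i : 'I_(arity c) => Var 0]) => x [i _].
by case: i => i; rewrite c0.
Qed.

Lemma least_herbrand_ground (S : signature) (P : program S) u :
  least_herbrand P u -> ground u.
Proof. by case=> i c s _ gs _; apply: ground_app_term. Qed.

(** * Most general matchers against ground terms *)

(** When [app_term s h] is ground, this is a most general matcher of [h] against it, whatever [s]
    does outside [h]. *)
Definition restrict (S : signature) (s : nat -> term S) (h : term S) (x : nat) :
    term S :=
  if excluded_middle_informative (occurs x h) then s x else Var x.

Lemma restrict_occurs (S : signature) (s : nat -> term S) h x :
  occurs x h -> restrict s h x = s x.
Proof. by rewrite /restrict; case: excluded_middle_informative. Qed.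

Lemma restrict_not_occurs (S : signature) (s : nat -> term S) h x :
  ~ occurs x h -> restrict s h x = Var x.
Proof. by rewrite /restrict; case: excluded_middle_informative. Qed.

Lemma restrict_idem (S : signature) (s : nat -> term S) h x :
  ground (app_term s h) ->
  app_term (restrict s h) (restrict s h x) = restrict s h x.
Proof.
move=> gh; have [xh|xh] := excluded_middle_informative (occurs x h).
  by rewrite restrict_occurs // app_term_ground //; apply: ground_app_term_occurs xh.
by rewrite restrict_not_occurs //= restrict_not_occurs.
Qed.

Definition restrict_subst (S : signature) (s : nat -> term S) h
    (gh : ground (app_term s h)) : subst S :=
  Subst (fun x => restrict_idem x gh).

Lemma restrict_subst_matcher (S : signature) (s : nat -> term S) h
    (gh : ground (app_term s h)) :
  matcher h (app_term s h) (restrict_subst gh).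
Proof. by apply: app_term_ext => x /= /restrict_occurs. Qed.

(** Any matcher [th'] agrees with [s] on [h], where the values are ground, and the restriction is
    the identity elsewhere; hence [th'] is its own factor. *)
Lemma ground_mgm_exists (S : signature) (s : nat -> term S) h :
  ground (app_term s h) -> exists th, mgm h (app_term s h) th.
Proof.
move=> gh; exists (restrict_subst gh); split; first exact: restrict_subst_matcher.
move=> th' /app_term_inj th's; exists th' => x /=.
have [xh|xh] := excluded_middle_informative (occurs x h).
  rewrite restrict_occurs // th's // app_term_ground //.
  exact: ground_app_term_occurs xh.
by rewrite restrict_not_occurs.
Qed.

(** [th] is compared with its own restriction to [h]. The factor [s] maps [th x] to [Var x], so
    [th x] is a variable [y]. Idempotence gives [th y = Var y], so the restriction maps [y] to
    [Var x]. If [y] occurred in [h], its value would be ground; hence [y = x]. *)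
Lemma ground_mgm_fixes (S : signature) (h u : term S) th x :
  mgm h u th -> ground u -> ~ occurs x h -> th x = Var x.
Proof.
move=> [thu most] gu xh; move: most; rewrite -{}thu in gu * => most.
have [s /= sE] := most _ (restrict_subst_matcher gu).
have := sE x; rewrite restrict_not_occurs //.
case thx: (th x) => [y|//] /= syx.
have thy : th y = Var y by rewrite -[LHS]/(app_term th (Var y)) -thx subst_idem.
have := sE y; rewrite thy /= -syx.
have [yh|yh] := excluded_middle_informative (occurs y h).
  rewrite restrict_occurs // => thyx.
  by have := ground_app_term_occurs gu yh; rewrite thyx => /(_ x) [].
by rewrite restrict_not_occurs // => ->.
Qed.

(** * Instances and variants of clauses *)

Lemma app_dclause_ext (S : signature) (s s' : nat -> term S) c :
  (forall x, occurs_dclause x c -> s x = s' x) ->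
  app_dclause s c = app_dclause s' c.
Proof.
case: c => h b ss'; congr DClause.
  by apply: app_term_ext => x xh; apply: ss'; left.
rewrite /=; have {}ss' x : occurs_body x b -> s x = s' x.
  by move=> xb; apply: ss'; right.
elim: b ss' => //= B b IH ss'; congr cons.
  by apply: app_term_ext => x xB; apply: ss'; exists 0, B.
by apply: IH => x [j [B' xB']]; apply: ss'; exists j.+1, B'.
Qed.

Lemma app_dclause_comp (S : signature) (s s' : nat -> term S) c :
  app_dclause s (app_dclause s' c) = app_dclause (fun x => app_term s (s' x)) c.
Proof.
case: c => h b; rewrite /app_dclause /= app_term_comp -map_comp.
by congr DClause; apply: eq_map => B; apply: app_term_comp.
Qed.

(** On head variables [th] already has the ground values of [s]; on variables found only in the body
    [th] is the identity, so [sigma] supplies the value. *)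
Lemma app_dclause_mgm (S : signature) (sigma s th : subst S) c :
  mgm (head c) (app_term s (head c)) th -> grounding s ->
  (forall x, occurs_dclause x c -> sigma x = s x) ->
  app_dclause sigma (app_dclause th c) = app_dclause s c.
Proof.
move=> mgm_th gs sigma_s; rewrite app_dclause_comp; apply: app_dclause_ext => x xc.
have [xh|xh] := excluded_middle_informative (occurs x (head c)).
  case: (mgm_th) => /app_term_inj -> // _.
  exact: app_term_ground.
rewrite (ground_mgm_fixes mgm_th) //=; first exact: sigma_s.
exact: ground_app_term.
Qed.

Lemma variant_ground_subst (S : signature) (c c' : dclause S) (s : subst S) :
  variant c c' -> grounding s ->
  exists2 s' : subst S, grounding s' & app_dclause s' c' = app_dclause s c.
Proof.
move=> [r r_inj ->] gs.
(* [s'] inverts the renaming on its range; [s 0] is an arbitrary ground default elsewhere. *)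
pose s' x := match excluded_middle_informative (exists y, r y = x) with
  | left e => s (proj1_sig (constructive_indefinite_description _ e))
  | right _ => s 0 end.
have gs' x : ground (s' x).
  by rewrite /s'; case: excluded_middle_informative => *; apply: gs.
exists (ground_subst gs') => //.
rewrite app_dclause_comp; apply: app_dclause_ext => x _ /=.
rewrite /s'; case: excluded_middle_informative => [e|[]]; last by exists x.
by case: constructive_indefinite_description => y /= /r_inj ->.
Qed.

(** * Labels of the rewriting tree *)

(** Hides the choice of matcher: later arguments work with an arbitrary most general one. *)
Lemma or_childP (S : signature) (sigma : subst S) c u w :
  (exists2 th, mgm (head c) u th &
     or_child sigma c u w
       = LClause (Definite (app_dclause sigma (app_dclause th c))))
  \/ (~ exists th, mgm (head c) u th) /\ or_child sigma c u w = LOrVar w.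
Proof.
rewrite /or_child; case: excluded_middle_informative => [h|]; last by right.
by left; case: constructive_indefinite_description => th th_mgm /=; exists th.
Qed.

Lemma descend_rcons (S : signature) (Q : renaming S) P sigma w l v i :
  descend Q P sigma w l (rcons v i)
    = obind (fun l' => child Q P sigma (w ++ v) l' i) (descend Q P sigma w l v).
Proof.
elim: v w l => [|j v IH] w l /=; first by rewrite cats0; case: child.
by case: child => //= l'; rewrite IH cat_rcons.
Qed.

Lemma rew_rcons (S : signature) (Q : renaming S) P C sigma w i :
  rew Q P C sigma (rcons w i)
    = obind (fun l => child Q P sigma w l i) (rew Q P C sigma w).
Proof. exact: descend_rcons. Qed.

(** Invariant of the tree: parity fixes the kind of a non-variable label, and such a label is a
    [sigma]-image, so that idempotence of [sigma] applies to it. *)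
Definition label_spec (S : signature) (sigma : subst S) (w : position)
    (l : label S) : Prop :=
  match l with
  | LClause C => ~~ odd (size w) /\ exists C', C = app_clause sigma C'
  | LTerm u => odd (size w) /\ exists u', u = app_term sigma u'
  | LOrVar _ => True
  end.

Lemma onth_map_Some (A B : Type) (f : A -> B) s j y :
  onth (map f s) j = Some y -> exists2 x, onth s j = Some x & y = f x.
Proof.
elim: s j => [|a s IH] [|j] //=; last exact: IH.
by case=> <-; exists a.
Qed.

Lemma rew_label (S : signature) (Q : renaming S) P C sigma w l :
  rew Q P C sigma w = Some l -> label_spec sigma w l.
Proof.
elim/last_ind: w l => [|w i IH] l.
  by move=> [<-]; split=> //; exists C.
rewrite rew_rcons; case: (rew Q P C sigma w) IH => //= l' /(_ l' erefl).
case: l' => //= [C' [ev [C'' ->]]|u [od _]].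
  case E: onth => [B|] //= [<-] /=; rewrite size_rcons /= ev; split=> //.
  case: C'' E => /= [c|b] E; have [B' _ ->] := onth_map_Some E; by exists B'.
case: ifP => // _ [<-].
case: (or_childP sigma (Q w i) u (rcons w i)) => [[th _ ->]|[_ ->]] //=.
by rewrite size_rcons /= od; split=> //; exists (Definite (app_dclause th (Q w i))).
Qed.

Lemma onth_ltn_Some (A : Type) (s : seq A) i :
  i < size s -> exists x, onth s i = Some x.
Proof. by elim: s i => [|a s IH] [|i] //=; [exists a | apply: IH]. Qed.

Lemma onth_Some_ltn (A : Type) (s : seq A) i x : onth s i = Some x -> i < size s.
Proof. by elim: s i => [|a s IH] [|i] //=; apply: IH. Qed.

(** * Soundness *)

Lemma inductive_success_sound (S : signature) (P : program S) (Q : renaming S)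
    C (sigma : subst S) (T' : tree S) :
  (forall w i c, onth P i = Some c -> variant c (Q w i)) ->
  rewriting_subtree T' (rew Q P C sigma) -> finite_tree T' ->
  (forall w, leaf T' w -> inductive_success_node (rew Q P C sigma) w) ->
  forall w u (tau : subst S), T' w = Some (LTerm u) -> grounding tau ->
    least_herbrand P (app_term tau u).
Proof.
move=> variantQ [_ T'T _ T'or T'and] [s T's] leafT' w u tau.
(* Positions of the finite subtree have bounded length; the induction is on the distance to this
   bound. *)
pose N := \max_(v <- s) size v.
have T'N v l : T' v = Some l -> size v <= N.
  move=> T'v; have vs : v \in s by apply: T's; exists l.
  by rewrite /N (big_rem v vs) /= leq_maxl.
have [n] := ubnP (N - size w).
elim: n => // n IH in w u tau *; rewrite ltnS => wn T'w gtau.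
have Tw := T'T _ _ T'w; have /= [od [u' uE]] := rew_label Tw.
have [|i [[l T'wi] _]] := T'and w _ od; first by exists (LTerm u).
have Twi := T'T _ _ T'wi.
have := Twi; rewrite rew_rcons Tw /=; case: ifP => // iP [lE].
have [c Pi] := onth_ltn_Some iP.
have [r _ QE] := variantQ w i c Pi.
have even_wi : ~~ odd (size (rcons w i)) by rewrite size_rcons /= od.
case: (or_childP sigma (Q w i) u (rcons w i)) lE => [[th [thu _] ->]|[_ ->]] lE;
    last first.
  (* An or-node variable has no children, so it would be a leaf of [T'] that is not an inductive
     success node. *)
  case: (leafT' (rcons w i)).
    split=> [|j [l' T'wij]]; first by exists l.
    by move: (T'T _ _ T'wij); rewrite rew_rcons Twi -lE.
  by move=> _ _ /(_ (rcons w i)); rewrite Twi lE.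
rewrite -{}lE in T'wi Twi.
(* Renaming, matcher, [sigma] and [tau] compose to a grounding substitution for the original clause
   [c]. *)
pose rho x := app_term tau (app_term sigma (th (r x))).
have grho x : ground (rho x) by apply: ground_app_term.
have rhoE B : app_term rho B
    = app_term tau (app_term sigma (app_term th (app_term (fun x => Var (r x)) B))).
  by rewrite !app_term_comp; apply: app_term_ext => x _; rewrite /rho app_term_comp.
have -> : app_term tau u = app_term (ground_subst grho) (head c).
  have -> : u = app_term sigma u by rewrite uE app_term_idem.
  by rewrite -thu QE /= rhoE.
apply: (LeastHerbrand Pi) => //= j B cj.
have Twij : rew Q P C sigma (rcons (rcons w i) j)
    = Some (LTerm (app_term sigma (app_term th (app_term (fun x => Var (r x)) B)))).
  by rewrite rew_rcons Twi /= QE /= !onth_map cj.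
have [||l' T'wij] := T'or (rcons w i) j _ even_wi; [by eexists; exact: T'wi | by eexists; exact: Twij |].
have := T'T _ _ T'wij; rewrite Twij => -[l'E]; rewrite -{}l'E in T'wij.
rewrite rhoE; apply: (IH _ _ _ _ T'wij) => //.
have := T'N _ _ T'wij; rewrite !size_rcons => lt_wN.
apply: leq_trans wn.
by rewrite ltn_sub2l // ltnW.
Qed.

(** * Success subtrees as finite lists of positions *)

(* [b] tells whether the root of [T] is an and-node. *)
Definition success_domain (S : signature) (b : bool) (T : tree S)
    (D : seq position) : Prop :=
  [/\ [::] \in D,
      forall v i, rcons v i \in D -> v \in D,
      forall v, v \in D -> ~~ (b (+) odd (size v)) ->
        (exists C, T v = Some (LClause C)) /\
        forall i, node T (rcons v i) -> rcons v i \in D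
    & forall v, v \in D -> b (+) odd (size v) ->
        node T v /\ exists! i, rcons v i \in D].

(** The subtree is [T] restricted to [D]. Its leaves have even depth, since odd positions keep a
    child, and they are leaves of [T], since even positions keep all children. *)
Lemma success_domain_tree (S : signature) (T : tree S) D :
  success_domain false T D -> inductive_success_tree T.
Proof.
move=> [D0 Dpre Deven Dodd].
pose T' : tree S := fun w => if w \in D then T w else None.
have nodeT' w : node T' w <-> w \in D.
  split=> [[l]|wD]; first by rewrite /T'; case: ifP.
  rewrite /node /T' wD; case: (boolP (odd (size w))) => [od|ev].
    by have [] := Dodd w wD od.
  by have [[C ->] _] := Deven w wD ev; exists (LClause C).
exists T'; split.
- split; first exact/nodeT'.
  + by move=> w l; rewrite /T'; case: ifP.
  + by move=> w i /nodeT' /Dpre /nodeT'.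
  + by move=> w i /nodeT' wD ev ?; apply/nodeT'; apply: (Deven w wD ev).2.
  + move=> w /nodeT' wD od; have [_ [i [iD iu]]] := Dodd w wD od.
    by exists i; split; [exact/nodeT' | move=> j /nodeT' /iu].
- by exists D => w /nodeT'.
- move=> w [/nodeT' wD noch].
  have ev : ~~ odd (size w).
    apply/negP => od; have [_ [i [/nodeT' iD _]]] := Dodd w wD od.
    exact: noch iD.
  have [[C Tw] ch] := Deven w wD ev.
  split=> // [|X]; last by rewrite Tw.
  split=> [|i /ch /nodeT']; [by exists (LClause C) | exact: noch].
Qed.

Lemma success_domain_and (S : signature) (T : tree S) u i D :
  T [::] = Some (LTerm u) -> success_domain false (fun v => T (i :: v)) D ->
  success_domain true T ([::] :: map (cons i) D).
Proof.
move=> T0 [D0 Dpre Deven Dodd]; set E := _ :: _.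
have inE0 j v : (j :: v \in E) = (j == i) && (v \in D).
  rewrite in_cons /=; apply/mapP/andP => [[v' v'D [-> ->]] //|[/eqP -> vD]].
  by exists v.
split=> //.
- move=> [|j v] k //; rewrite rcons_cons !inE0 => /andP[-> /Dpre ->] //.
- move=> [|j v] //; rewrite inE0 /= negbK => /andP[/eqP -> vD] ev.
  have [? ch] := Deven v vD ev; split=> // k /ch.
  by rewrite inE0 eqxx.
- move=> [|j v] /=.
    move=> _ _; split; first by exists (LTerm u).
    exists i; split; first by rewrite inE0 eqxx.
    by move=> k; rewrite inE0 => /andP[/eqP].
  rewrite inE0 negbK => /andP[/eqP -> vD] od.
  have [? [k [kD ku]]] := Dodd v vD od; split=> //; exists k.
  by split=> [|k']; rewrite inE0 eqxx //; apply: ku.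
Qed.

(** The case [m = 0] gives the one-node domain of a fact, where the recursive construction ends. *)
Lemma success_domain_or (S : signature) (T : tree S) C m
    (D : nat -> seq position) :
  T [::] = Some (LClause C) -> (forall j, node T [:: j] -> j < m) ->
  (forall j, j < m -> success_domain true (fun v => T (j :: v)) (D j)) ->
  success_domain false T ([::] :: [seq j :: v | j <- iota 0 m, v <- D j]).
Proof.
move=> T0 Tm DP; set E := _ :: _.
have inE0 j v : (j :: v \in E) = (j < m) && (v \in D j).
  rewrite in_cons /=; apply/allpairsPdep/andP => [[k [v' []]]|[jm vD]].
    by rewrite mem_iota add0n => /= km v'D [-> ->].
  by exists j, v; rewrite mem_iota.
split=> //.
- move=> [|j v] k //; rewrite rcons_cons !inE0 => /andP[jm].
  by rewrite jm; case: (DP j jm) => _ Dpre _ _ /Dpre.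
- move=> [|j v] /=.
    move=> _ _; split; first by exists C.
    move=> j /Tm jm; rewrite inE0 jm.
    by case: (DP j jm).
  rewrite inE0 => /andP[jm vD] ev.
  have [_ _ /(_ v vD ev) [? ch] _] := DP j jm; split=> // k /ch.
  by rewrite inE0 jm.
- move=> [|j v] //=; rewrite inE0 => /andP[jm vD] od.
  have [_ _ _ /(_ v vD od) [? [k [kD ku]]]] := DP j jm; split=> //; exists k.
  by split=> [|k']; rewrite inE0 jm //; apply: ku.
Qed.

(** * Completeness *)

Definition occurs_below (S : signature) (Q : renaming S) (P : program S)
    (w : position) (x : nat) : Prop :=
  exists v i, i < size P /\ occurs_dclause x (Q (w ++ v) i).

Lemma renamed_apart_eq (S : signature) (Q : renaming S) P C w i w' i' x :
  renamed_apart Q P C -> i < size P -> i' < size P ->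
  occurs_dclause x (Q w i) -> occurs_dclause x (Q w' i') -> w = w'.
Proof.
move=> [_ disjQ _] iP i'P xw xw'; apply/eqP/negP => /negP ww'.
apply: (disjQ w i w' i') xw' => // -[wE _].
by rewrite wE eqxx in ww'.
Qed.

(** The copy at [w] and the copies below the different nodes [w i j] have disjoint variables, so the
    assignments can be glued; [g0] also serves as the default. *)
Lemma paste_assignments (S : signature) (P : program S) (Q : renaming S) C w i
    (g0 : nat -> term S) (g : nat -> nat -> term S) :
  renamed_apart Q P C -> i < size P ->
  (forall x, ground (g0 x)) -> (forall j x, ground (g j x)) ->
  exists h : nat -> term S,
    [/\ forall x, ground (h x),
        forall x, occurs_dclause x (Q w i) -> h x = g0 x
      & forall j x, occurs_below Q P (rcons (rcons w i) j) x -> h x = g j x].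
Proof.
move=> apart iP gg0 gg.
pose h x := match excluded_middle_informative
                    (exists j, occurs_below Q P (rcons (rcons w i) j) x) with
  | left e => g (proj1_sig (constructive_indefinite_description _ e)) x
  | right _ => g0 x end.
exists h; split=> [x|x xwi|j x xj]; rewrite /h; case: excluded_middle_informative.
- by move=> e; apply: gg.
- by move=> _; apply: gg0.
(* A shared variable would make [w] equal to a proper extension of itself. *)
- move=> e; have [j [v [i' [i'P xv]]]] := e; exfalso.
  have /(congr1 size) := renamed_apart_eq apart iP i'P xwi xv.
  by rewrite size_cat !size_rcons !addSn => /eqP; rewrite ltn_eqF // ltnS leqW // leq_addr.
- by [].
- move=> e; case: (constructive_indefinite_description _ e) => j' /= xj'.
  case: xj xj' => [v [k [kP xv]]] [v' [k' [k'P xv']]].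
  have /eqP := renamed_apart_eq apart kP k'P xv xv'.
  (* Both positions extend [w i], so the next entries [j] and [j'] coincide. *)
  by rewrite !cat_rcons eqseq_cat // => /andP[_ /eqP[->]].
- by case; exists j.
Qed.

(** Induction on the derivation, for all [w] at once because the premises are used at deeper
    positions. [g] is chosen before [sigma], and [sigma] is constrained only below [w], so that one
    [sigma] can serve all branches. *)
Lemma least_herbrand_success (S : signature) (P : program S) (Q : renaming S) C u :
  renamed_apart Q P C -> least_herbrand P u ->
  forall w, exists2 g : nat -> term S, (forall x, ground (g x)) &
    forall sigma : subst S, grounding sigma ->
      (forall x, occurs_below Q P w x -> sigma x = g x) ->
      exists D, success_domain true (descend Q P sigma w (LTerm u)) D.
Proof.
move=> apart; elim=> {u} i c s Pi gs _ IH w.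
have iP := onth_Some_ltn Pi.
have [variantQ _ _] := apart.
have [s' gs' s'E] := variant_ground_subst (variantQ w i c Pi) gs.
pose good j (g : nat -> term S) := (forall x, ground (g x)) /\
  forall B, onth (body c) j = Some B -> forall sigma : subst S, grounding sigma ->
    (forall x, occurs_below Q P (rcons (rcons w i) j) x -> sigma x = g x) ->
    exists D, success_domain true
      (descend Q P sigma (rcons (rcons w i) j) (LTerm (app_term s B))) D.
have ex_good j : exists g, good j g.
  case E: (onth (body c) j) => [B|]; last first.
    (* Past the end of the body any ground assignment will do. *)
    by exists s; split=> // B; rewrite E.
  have [g gg gB] := IH j B E (rcons (rcons w i) j).
  by exists g; split=> // B'; rewrite E => -[<-].
pose g j := proj1_sig (constructive_indefinite_description _ (ex_good j)).
have gP j : good j (g j) by rewrite /g; case: constructive_indefinite_description.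
have [h [gh h_s' h_g]] :=
  paste_assignments (g := g) w apart iP gs' (fun j => (gP j).1).
exists h => // sigma gsigma sigma_h.
have sigma_s' x : occurs_dclause x (Q w i) -> sigma x = s' x.
  move=> xwi; rewrite sigma_h ?h_s' //.
  by exists [::], i; rewrite cats0.
have sigma_g j x : occurs_below Q P (rcons (rcons w i) j) x -> sigma x = g j x.
  move=> xj; rewrite -h_g // sigma_h //.
  case: xj => v [k [kP xv]]; exists [:: i, j & v], k; split=> //.
  by rewrite -!cat_rcons.
have headE : app_term s (head c) = app_term s' (head (Q w i)).
  by have := congr1 (@head S) s'E.
(* Whichever matcher is chosen, child [i] carries exactly the clause instance used in the
   derivation. *)
have or_childE : or_child sigma (Q w i) (app_term s (head c)) (rcons w i)
    = LClause (Definite (app_dclause s c)).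
  have gu : ground (app_term s' (head (Q w i))) by apply: ground_app_term.
  rewrite headE -s'E.
  case: (or_childP sigma (Q w i) (app_term s' (head (Q w i))) (rcons w i)).
    by move=> [th th_mgm ->]; rewrite (app_dclause_mgm th_mgm).
  by move=> [no_mgm _]; case: no_mgm; apply: ground_mgm_exists.
pose spec j D := j < size (body c) -> success_domain true
  (fun v => descend Q P sigma (rcons w i) (LClause (Definite (app_dclause s c))) (j :: v)) D.
have ex_spec j : exists D, spec j D.
  case: (ltnP j (size (body c))) => [/onth_ltn_Some [B jB]|cj]; last first.
    by exists [::]; rewrite /spec ltnNge cj.
  have [D DP] := (gP j).2 B jB sigma gsigma (sigma_g j).
  by exists D => _; rewrite /= onth_map jB.
pose D j := proj1_sig (constructive_indefinite_description _ (ex_spec j)).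
have DP j : spec j (D j) by rewrite /D; case: constructive_indefinite_description.
eexists; apply: (@success_domain_and _ _ (app_term s (head c)) i) => //=.
rewrite iP or_childE.
apply: success_domain_or DP => // j [l] /=.
rewrite onth_map; case E: onth => [B|] // _; exact: onth_Some_ltn E.
Qed.

Theorem theorem3p9 (S : signature) (hS : exists c : S, arity c = 0)
    (P : program S) (t : term S) (Q : renaming S)
    (hQ : renamed_apart Q P (Goal [:: t])) :
  (forall sigma : subst S,
      matched_apart Q P (Goal [:: t]) sigma ->
      inductive_success_tree (rew Q P (Goal [:: t]) sigma) ->
      forall t' : term S, ground t' -> instance t' (app_term sigma t) ->
        least_herbrand P t')
  /\
  (least_herbrand P t ->
    exists theta : subst S,
      [/\ grounding theta,
          matched_apart Q P (Goal [:: t]) theta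
        & inductive_success_tree (rew Q P (Goal [:: t]) theta)]).
Proof.
split=> [sigma _ [T' [subT' finT' leafT']] t' gt' [s t'E]|Mt].
  have [T'0 T'T _ T'or _] := subT'.
  have [|l T'l] := T'or [::] 0 T'0 isT.
    by exists (LTerm (app_term sigma t)).
  have := T'T _ _ T'l => -[lE]; rewrite -{}lE in T'l.
  (* [s] need not be grounding; its remaining variables are sent to a ground term [k], which leaves
     the ground [t'] unchanged. *)
  have [k gk] := ground_term_exists hS.
  have gtau x : ground (app_term (fun=> k) (s x)) by apply: ground_app_term.
  have [variantQ _ _] := hQ.
  have := inductive_success_sound variantQ subT' finT' leafT'
    T'l (tau := ground_subst gtau) gtau.
  by rewrite /= -app_term_comp -t'E app_term_ground.
(* The goal has one body atom, so [[:: 0]] is the only child of the root. *)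
have [g gg gP] := least_herbrand_success hQ Mt [:: 0].
exists (ground_subst gg); split=> //.
  (* Every term label is an image of a grounding substitution, hence ground. *)
  move=> w u i Tw iP x _.
  have [_ [u' ->]] := rew_label Tw.
  exact: ground_app_term.
have [D DP] := gP (ground_subst gg) gg (fun _ _ => erefl).
apply: (success_domain_tree (D := [::] :: [seq j :: v | j <- iota 0 1, v <- D])).
apply: success_domain_or => //; first by case=> [//|[|j]] [l].
case=> // _; rewrite /rew /= app_term_ground //.
exact: least_herbrand_ground Mt.
Qed.
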